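(* For all $n\ge1$ and $f\in C[0,1]$, $$F_nf=\sum_{j=0}^n\left[0,\tfrac1n,\dots,\tfrac jn;f\right]\rho_{n,j},$$ where $$\rho_{n,j}=\frac1{(n-j)!\,n^{2j-1}}\sum_{k=0}^j(-1)^{j-k}(n+k-1)!\,S(j,k)\,e_k,\qquad 0\le j\le n.$$
   Context: $e_k(x)=x^k$; $S(j,k)$ are the Stirling numbers of the second kind; $[x_0,\dots,x_j;f]$ is the divided difference of $f$ at the knots $x_0,\dots,x_j$. $\Pi_n$ is the space of polynomials of degree at most $n$. The Bernstein operator is $B_n(f;x)=\sum_{k=0}^n f(k/n)\binom nk x^k(1-x)^{n-k}$. The genuine Beta operator $\bar{\mathbb{B}}_n:C[0,1]\to C[0,1]$ is defined by $\bar{\mathbb{B}}_n(f;0)=f(0)$, $\bar{\mathbb{B}}_n(f;1)=f(1)$, and for $x\in(0,1)$ $$\bar{\mathbb{B}}_n(f;x)=\frac{1}{B(nx,n(1-x))}\int_0^1 t^{nx-1}(1-t)^{n(1-x)-1}f(t)\,dt,$$ where $B(\cdot,\cdot)$ is the Euler Beta function. $\bar{\mathbb{B}}_n$ restricts to a bijection $\Pi_n\to\Pi_n$, with inverse $\bar{\mathbb{B}}_n^{-1}$, and $F_n:=\bar{\mathbb{B}}_n^{-1}\circ B_n:C[0,1]\to\Pi_n$. *)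

(* Defs.v *)
From mathcomp Require Import all_boot all_order all_algebra.
From mathcomp Require Import all_classical all_reals all_analysis.
Set Implicit Arguments.
Unset Strict Implicit.
Unset Printing Implicit Defensive.
Import Order.TTheory GRing.Theory Num.Theory.
Import numFieldNormedType.Exports.
Local Open Scope classical_set_scope.
Local Open Scope ring_scope.

(* Elements of C[0,1] are functions f : R -> R that are continuous within
   [0,1]; every operator below only uses the values of f on [0,1].  Elements
   of Pi_n are polynomials p : {poly R} with size p <= n.+1. *)

(* The library's beta_fun only takes natural number parameters. *)
Definition euler_beta (R : realType) (a b : R) : R :=
  \int[lebesgue_measure]_(t in `[0, 1]) (t `^ (a - 1) * (1 - t) `^ (b - 1)).

Definition genuine_beta (R : realType) (n : nat) (f : R -> R) (x : R) : R :=
  if x == 0 then f 0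
  else if x == 1 then f 1
  else (euler_beta (n%:R * x) (n%:R * (1 - x)))^-1 *
       \int[lebesgue_measure]_(t in `[0, 1])
         (t `^ (n%:R * x - 1) * (1 - t) `^ (n%:R * (1 - x) - 1) * f t).

Definition bernstein (R : realType) (n : nat) (f : R -> R) : {poly R} :=
  \sum_(k < n.+1) (f (k%:R / n%:R) *+ 'C(n, k)) *: ('X^k * (1 - 'X) ^+ (n - k)).

(* Inverse of the bijection of Pi_n induced by genuine_beta n: the polynomial p
   of degree at most n whose image under genuine_beta n is q, as functions on
   [0,1].  The value 0 is only used when there is no such p. *)
Definition genuine_beta_inv (R : realType) (n : nat) (q : {poly R}) : {poly R} :=
  xget 0 [set p : {poly R} | (size p <= n.+1)%N /\
    forall x : R, 0 <= x <= 1 -> genuine_beta n (horner p) x = q.[x]].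

Definition F_op (R : realType) (n : nat) (f : R -> R) : {poly R} :=
  genuine_beta_inv n (bernstein n f).

(* divided_diff f x i j = [x_i, ..., x_(i+j); f], for pairwise distinct knots. *)
Fixpoint divided_diff (R : realType) (f : R -> R) (x : nat -> R) (i j : nat) : R :=
  if j is j'.+1 then
    (divided_diff f x i.+1 j' - divided_diff f x i j') / (x (i + j)%N - x i)
  else f (x i).

(* S(j,k), the Stirling numbers of the second kind. *)
Fixpoint stirling2 (j k : nat) : nat :=
  match j, k with
  | 0, 0 => 1%N
  | 0, _.+1 => 0%N
  | _.+1, 0 => 0%N
  | j'.+1, k'.+1 => (k * stirling2 j' k + stirling2 j' k')%N
  end.

Definition rho (R : realType) (n j : nat) : {poly R} :=
  ((n - j)`!%:R * n%:R ^ (2 * j%:Z - 1))^-1 *: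
  \sum_(k < j.+1)
    ((-1) ^+ (j - k) * ((n + k - 1)`! * stirling2 j k)%:R) *: 'X^k.

(* Main.v *)
From HB Require Import structures.
Require Import Defs.
From mathcomp Require Import all_boot all_order all_algebra.
From mathcomp Require Import all_classical all_reals all_analysis.
From mathcomp Require Import measurable_realfun.
From mathcomp Require Import ring lra.
Set Implicit Arguments.
Unset Strict Implicit.
Import Order.TTheory GRing.Theory Num.Theory.
Import numFieldNormedType.Exports.
Local Open Scope classical_set_scope.
Local Open Scope ring_scope.

(* Write (y)_k = y (y+1) ... (y+k-1).  The recurrence
   B(a+1,b) = a/(a+b) B(a,b) shows that the genuine Beta operator maps e_k to
   (nx)_k / (n)_k, a polynomial of degree exactly k, so on polynomials of degree
   at most n it is injective.  The Bernstein polynomial has the Newton form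
   sum_j C(n,j) Delta^j f(0) x^j = sum_j [0,..,j/n; f] n!/((n-j)! n^j) x^j, and
   (nx)^j = sum_k (-1)^(j-k) S(j,k) (nx)_k.  Replacing (nx)_k by (n)_k e_k gives
   the preimage of each x^j, which is rho_{n,j} up to the stated factor. *)

(** * Rising factorials, Stirling numbers and finite differences *)

Definition rising (A : pzRingType) (y : A) (k : nat) : A := \prod_(i < k) (y + i%:R).

Lemma risingS (A : pzRingType) (y : A) k : rising y k.+1 = rising y k * (y + k%:R).
Proof. by rewrite /rising big_ord_recr. Qed.

Lemma stirling2_small j k : (j < k)%N -> stirling2 j k = 0%N.
Proof.
elim: j k => [|j IH] [|k] //= jk.
by rewrite !IH ?muln0// ltnW.
Qed.

(** Induction on [j]: since y (y)_k = (y)_{k+1} - k (y)_k, multiplying the expansion by y reproduces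
    the Stirling recurrence, with alternating signs because the factorials rise. *)
Lemma expr_rising (A : comNzRingType) (y : A) j :
  y ^+ j = \sum_(k < j.+1) (-1) ^+ (j - k) * (stirling2 j k)%:R * rising y k.
Proof.
elim: j => [|j IH].
  by rewrite big_ord_recl big_ord0 /rising big_ord0 !expr0 /= !mulr1 addr0.
rewrite exprSr IH mulr_suml [RHS]big_ord_recl /= mulr0 mul0r add0r.
pose G k : A := (-1) ^+ (j - k) * (stirling2 j k)%:R.
transitivity (\sum_(k < j.+1) (G k * rising y k.+1 - k%:R * G k * rising y k)).
  by apply: eq_bigr => k _; rewrite risingS /G; ring.
rewrite big_split/=.
(* The sum may be shifted by one index: its term at k = 0 carries the factor 0, and the new last
   term vanishes because S(j,j+1) = 0. *)
have -> : \sum_(k < j.+1) - (k%:R * G k * rising y k) =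
   \sum_(k < j.+1) - (k.+1%:R * G k.+1 * rising y k.+1).
  rewrite big_ord_recl/= !mul0r oppr0 add0r [RHS]big_ord_recr/=.
  have Gj : G j.+1 = 0 by rewrite /G stirling2_small// mulr0.
  by rewrite Gj mulr0 mul0r oppr0 addr0.
rewrite -big_split/=; apply: eq_bigr => k _.
rewrite /bump /= !add1n subSS -mulNr -mulrDl; congr (_ * _).
rewrite natrD natrM /G.
(* For k < j the two signs differ by one factor -1. At k = j the truncated difference j - (k+1)
   would give a wrong sign, but it multiplies S(j,j+1) = 0. *)
have [kj|kj] := ltnP k j.
  by rewrite -(subnSK kj) exprS; ring.
by rewrite (@stirling2_small j k.+1)//; ring.
Qed.

(** * Divided differences on equidistant knots and the Newton form of the Bernstein polynomial *)

Definition fwd_diff (A : zmodType) (g : nat -> A) (i : nat) : A := g i.+1 - g i.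

(** On equidistant knots the denominator of the step from [j] to [j.+1] is (j+1)h whatever the first
    knot, and these factors accumulate to j! h^j. *)
Lemma divided_diff_eq (R : realType) (f : R -> R) (h : R) i j : h != 0 ->
  divided_diff f (fun i => i%:R * h) i j =
  iter j (@fwd_diff R) (fun i => f (i%:R * h)) i / (j`!%:R * h ^+ j).
Proof.
move=> h0; elim: j i => [|j IH] i /=; first by rewrite expr0 mulr1 divr1.
rewrite !IH /fwd_diff -mulrBl -mulrBl -natrB ?leq_addr// addKn.
have j0 : j.+1%:R != 0 :> R by rewrite pnatr_eq0.
have f0 : j`!%:R != 0 :> R by rewrite pnatr_eq0 -lt0n fact_gt0.
by rewrite -mulrA -invfM factS natrM exprS; congr (_ / _); ring.
Qed.

Lemma iter_fwd_diffS (A : zmodType) (g : nat -> A) j i :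
  iter j.+1 (@fwd_diff A) g i = iter j (@fwd_diff A) (fwd_diff g) i.
Proof. by rewrite iterSr. Qed.

(** An arbitrary sequence [g] is needed because the induction on [n] changes it: Pascal's rule gives
    (1-X) B_n(g) + X B_n(shifted g) = B_n(g) + X B_n(difference of g) at level n+1, and the Newton
    side obeys the same recursion. *)
Lemma bernstein_fwd_diff (A : comNzRingType) (g : nat -> A) n :
  \sum_(k < n.+1) (g k *+ 'C(n, k)) *: ('X^k * (1 - 'X) ^+ (n - k)) =
  \sum_(j < n.+1) (iter j (@fwd_diff A) g 0%N *+ 'C(n, j)) *: 'X^j :> {poly A}.
Proof.
(* Pascal's rule in summed form, applied below to both sides. *)
have binS (F : nat -> {poly A}) (c : nat -> A) m :
  \sum_(k < m.+2) (c k *+ 'C(m.+1, k)) *: F k =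
  \sum_(k < m.+1) (c k *+ 'C(m, k)) *: F k +
  \sum_(k < m.+1) (c k.+1 *+ 'C(m, k)) *: F k.+1.
  rewrite big_ord_recl bin0.
  under eq_bigr do rewrite lift0 binS mulrnDr scalerDl.
  rewrite big_split/= addrA; congr (_ + _).
  rewrite [RHS]big_ord_recl bin0 big_ord_recr /= bin_small// mulr0n scale0r addr0.
  by congr (_ + _); apply: eq_bigr => k _; rewrite lift0.
elim: n g => [|n IH] g; first by rewrite !big_ord1 /= !mulr1n !expr0 mulr1.
rewrite (binS (fun k => 'X^k * (1 - 'X) ^+ (n.+1 - k)) g).
rewrite (binS (fun k => 'X^k) (fun j => iter j (@fwd_diff A) g 0%N)).
transitivity ((1 - 'X) *
    \sum_(k < n.+1) (g k *+ 'C(n, k)) *: ('X^k * (1 - 'X) ^+ (n - k)) +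
  'X * \sum_(k < n.+1) (g k.+1 *+ 'C(n, k)) *: ('X^k * (1 - 'X) ^+ (n - k)) : {poly A}).
  rewrite !mulr_sumr; congr (_ + _); apply: eq_bigr => k _.
    rewrite -scalerAr subSn -1?ltnS// exprS; congr (_ *: _); ring.
  rewrite -scalerAr subSS exprS; congr (_ *: _); ring.
rewrite mulrBl mul1r -addrA; congr (_ + _); first exact: IH.
rewrite addrC -mulrBr -sumrB.
under eq_bigr do rewrite -scalerBl -mulrnBl.
rewrite (IH (fwd_diff g)) mulr_sumr; apply: eq_bigr => j _.
by rewrite -scalerAr -exprS -iter_fwd_diffS.
Qed.

(** * Rising factorials as polynomials and the action of the Beta operator on coefficients *)

Lemma rising_gt0 (R : numDomainType) (y : R) k : 0 < y -> 0 < rising y k.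
Proof. by move=> y0; apply: prodr_gt0 => i _; rewrite ltr_pwDl. Qed.

Lemma rising0 (A : pzRingType) k : rising (0 : A) k = (k == 0)%:R.
Proof.
case: k => [|k]; first by rewrite /rising big_ord0.
by rewrite /rising big_ord_recl addr0 mul0r.
Qed.

Lemma horner_rising (A : comNzRingType) (p : {poly A}) (x : A) k :
  (rising p k).[x] = rising p.[x] k.
Proof.
rewrite /rising horner_prod; apply: eq_bigr => i _.
by rewrite hornerD -[i%:R]polyC_natr hornerC.
Qed.

Lemma size_rising_scaleX (A : comNzRingType) (c : A) k :
  (size (rising (c *: 'X) k) <= k.+1)%N.
Proof.
elim: k => [|k IH]; first by rewrite /rising big_ord0 size_poly1.
rewrite risingS (leq_trans (size_polyMleq _ _))//.
have H : (size (c *: 'X + k%:R : {poly A})%R <= 2)%N.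
  rewrite (leq_trans (size_polyD _ _))// geq_max (leq_trans (size_scale_leq _ _)) ?size_polyX//=.
  by rewrite -polyC_natr (leq_trans (size_polyC_leq1 _)).
by rewrite -subn1 leq_subLR (leq_trans (leq_add IH H))// addn2 add1n.
Qed.

Lemma coef_rising_scaleX (A : comNzRingType) (c : A) k :
  (rising (c *: 'X) k)`_k = c ^+ k.
Proof.
elim: k => [|k IH]; first by rewrite /rising big_ord0 coef1 expr0.
rewrite risingS mulrDr coefD -scalerAr coefZ coefMX/= IH -exprS.
rewrite -polyC_natr coefMC (nth_default _ (size_rising_scaleX _ _)).
by rewrite mul0r addr0.
Qed.

(** Exposes in the factorials of [rho] the factor (n)_k by which [beta_poly] divides. With n > 0 the
    truncated n + k - 1 is the true one, also at k = 0. *)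
Lemma rising_nat (A : comPzRingType) n k : (0 < n)%N ->
  (n + k - 1)`!%:R = rising n%:R k * (n.-1)`!%:R :> A.
Proof.
case: n => // n _ /=; elim: k => [|k IH].
  by rewrite addn0 subn1 /rising big_ord0 mul1r.
rewrite risingS mulrAC -IH addnS !subn1 /= addSn factS natrM mulrC; congr (_ * _).
by rewrite -addSn natrD.
Qed.

(** Algebraic model of the genuine Beta operator on polynomials of degree at most [n], identified
    with the integral in [genuine_beta_horner]. Coefficients beyond degree [n] are dropped. *)
Definition beta_poly (R : fieldType) (n : nat) (p : {poly R}) : {poly R} :=
  \sum_(k < n.+1) (p`_k / rising n%:R k) *: rising (n%:R *: 'X) k.

Lemma beta_poly_is_linear (R : fieldType) (n : nat) : linear (@beta_poly R n).
Proof.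
move=> c p q; rewrite /beta_poly scaler_sumr -big_split/=.
apply: eq_bigr => k _.
by rewrite coefD coefZ mulrDl scalerDl scalerA mulrA.
Qed.

HB.instance Definition _ (R : fieldType) (n : nat) :=
  GRing.isLinear.Build R {poly R} {poly R} *:%R (@beta_poly R n)
    (@beta_poly_is_linear R n).

Lemma beta_polyXn (R : fieldType) (n k : nat) : (k <= n)%N ->
  beta_poly n 'X^k = (rising n%:R k)^-1 *: rising (n%:R *: 'X) k :> {poly R}.
Proof.
move=> kn; rewrite /beta_poly (bigD1 (Ordinal (kn : (k < n.+1)%N)))//=.
rewrite coefXn eqxx mul1r big1 ?addr0// => i ik.
rewrite coefXn; case: eqP => [E|_]; last by rewrite mul0r scale0r.
by move: ik; rewrite -val_eqE/= E eqxx.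
Qed.

(** Take the coefficient at d = deg p: terms of lower index have smaller degree, those of higher
    index have coefficient 0, and the term d contributes the leading coefficient times n^d / (n)_d,
    which is nonzero. *)
Lemma beta_poly_eq0 (R : numFieldType) (n : nat) (p : {poly R}) : (0 < n)%N ->
  (size p <= n.+1)%N -> beta_poly n p = 0 -> p = 0.
Proof.
move=> n0 sp p0; apply/eqP/negPn/negP => pn0.
have s0 : (0 < size p)%N by rewrite lt0n size_poly_eq0.
have dn : ((size p).-1 < n.+1)%N by rewrite prednK.
have nR0 : 0 < n%:R :> R by rewrite ltr0n.
have : (beta_poly n p)`_(size p).-1 = 0 by rewrite p0 coef0.
rewrite /beta_poly coef_sum (bigD1 (Ordinal dn))//= big1 ?addr0 => [|i id].
  rewrite coefZ coef_rising_scaleX => /eqP; rewrite !mulf_eq0 invr_eq0.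
  rewrite [rising _ _ == 0]gt_eqF ?rising_gt0// expf_eq0 [n%:R == 0]gt_eqF//.
  by rewrite andbF !orbF -/(lead_coef p) lead_coef_eq0 (negPf pn0).
rewrite coefZ; case: (ltngtP i (size p).-1) => [lt|gt|E].
- by rewrite (nth_default _ (leq_trans (size_rising_scaleX _ _) lt)) mulr0.
- by rewrite prednK// in gt; rewrite (nth_default _ gt) !mul0r.
- by move: id; rewrite -val_eqE/= E eqxx.
Qed.

(** The points 1/(i+1) with i below the size of [r] are more distinct roots than the degree
    allows. *)
Lemma poly_eq0_unit_itv (R : realFieldType) (r : {poly R}) :
  (forall x : R, 0 <= x <= 1 -> r.[x] = 0) -> r = 0.
Proof.
move=> r0; pose s : seq R := [seq i.+1%:R^-1 | i <- iota 0 (size r)].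
apply: (@roots_geq_poly_eq0 _ _ s).
- apply/allP => _ /mapP[i _ ->]; apply/rootP/r0.
  by rewrite invr_ge0 ler0n/= invf_le1 ?ltr0n// ler1n.
- rewrite map_inj_uniq ?iota_uniq// => i j /invr_inj/eqP.
  by rewrite eqr_nat eqSS => /eqP.
- by rewrite size_map size_iota.
Qed.

Lemma size_rho (R : realType) n j : (size (rho R n j) <= j.+1)%N.
Proof.
rewrite (leq_trans (size_scale_leq _ _))//.
apply: (leq_trans (size_sum _ _ _)); apply/bigmax_leqP => k _.
by rewrite (leq_trans (size_scale_leq _ _))// size_polyXn.
Qed.

(** The factor (n)_k from the factorial cancels the denominator in the image of e_k, leaving (n-1)!
    times the Stirling expansion of (nX)^j. *)
Lemma beta_poly_rho (R : realType) (n j : nat) : (0 < n)%N -> (j <= n)%N ->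
  beta_poly n (rho R n j) = (n`!%:R / ((n - j)`!%:R * n%:R ^+ j)) *: 'X^j.
Proof.
move=> n0 jn; have nR0 : n%:R != 0 :> R by rewrite pnatr_eq0 -lt0n.
rewrite linearZ linear_sum/=.
transitivity (((n - j)`!%:R * n%:R ^ (2 * j%:Z - 1))^-1 *:
    ((n.-1)`!%:R *: (n%:R *: 'X) ^+ j) : {poly R}).
  congr (_ *: _); rewrite expr_rising scaler_sumr; apply: eq_bigr => k _.
  have kn : (k <= n)%N by rewrite (leq_trans _ jn)// -ltnS.
  rewrite linearZ/= beta_polyXn// scalerA natrM rising_nat//.
  have -> : (-1) ^+ (j - k) * (stirling2 j k)%:R =
      ((-1) ^+ (j - k) * (stirling2 j k)%:R : R)%:P.
    by rewrite rmorphM rmorphXn/= rmorphN rmorph1 rmorph_nat.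
  rewrite mul_polyC scalerA.
  congr (_ *: _); field.
  by rewrite gt_eqF// rising_gt0// ltr0n.
rewrite exprZn !scalerA; congr (_ *: _).
(* The exponent is an integer, equal to -1 when j = 0, so it is split into natural powers and one
   inverse. *)
have -> : n%:R ^ (2 * j%:Z - 1) = n%:R ^+ j * n%:R ^+ j / n%:R :> R.
  by rewrite expfzDr// mulrDl mul1r expfzDr.
rewrite -[in n`!](prednK n0) factS natrM prednK//.
have ? : (n - j)`!%:R != 0 :> R by rewrite pnatr_eq0 -lt0n fact_gt0.
have ? : n%:R ^+ j != 0 :> R by rewrite expf_neq0.
by field; apply/and3P; split.
Qed.

(** Newton coefficients are compared: with h = 1/n the factor C(n,j) j! / n^j is the scalar of
    [beta_poly_rho]. *)
Lemma bernstein_beta_poly (R : realType) (n : nat) (f : R -> R) : (0 < n)%N ->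
  bernstein n f = beta_poly n
    (\sum_(j < n.+1) divided_diff f (fun i => i%:R / n%:R) 0 j *: rho R n j).
Proof.
move=> n0; have nR0 : n%:R != 0 :> R by rewrite pnatr_eq0 -lt0n.
rewrite /bernstein (bernstein_fwd_diff (fun k => f (k%:R / n%:R))) linear_sum.
apply: eq_bigr => j _; have jn : (j <= n)%N by rewrite -ltnS.
rewrite linearZ /= beta_poly_rho// scalerA; congr (_ *: _).
rewrite divided_diff_eq ?invr_neq0// -[LHS]mulr_natr -mulrA; congr (_ * _).
rewrite -(bin_fact jn) !natrM.
have ? : (n - j)`!%:R != 0 :> R by rewrite pnatr_eq0 -lt0n fact_gt0.
have ? : j`!%:R != 0 :> R by rewrite pnatr_eq0 -lt0n fact_gt0.
have ? : n%:R ^+ j != 0 :> R by rewrite expf_neq0.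
by rewrite exprVn; field; apply/and3P; split.
Qed.

(** * The Euler Beta function with real parameters *)

(** Compact exhaustion for the limit in [ge0_FTC2_oo]. The shift in [n.+3] keeps every interval
    nondegenerate, since 2/(n+3) < 1. *)
Lemma itv_oo_bigcup (R : realType) (a b : R) : a < b ->
  `]a, b[%classic =
  \bigcup_n `[a + (b - a) / n.+3%:R, b - (b - a) / n.+3%:R]%classic.
Proof.
move=> ab; have ba0 : 0 < b - a by rewrite subr_gt0.
apply/seteqP; split => x /=; rewrite in_itv/=.
  move=> /andP[ax xb].
  (* The distance from [x] to the nearer endpoint bounds the admissible margin. *)
  pose m := Num.min (x - a) (b - x).
  have m0 : 0 < m by rewrite lt_min !subr_gt0 ax xb.
  have [n nP] : exists n : nat, (b - a) / m < n%:R.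
    exists (Num.bound ((b - a) / m)).
    by rewrite archi_boundP// divr_ge0// ltW.
  have nm : (b - a) / n.+3%:R <= m.
    rewrite ler_pdivrMr// mulrC -ler_pdivrMr// (le_trans (ltW nP))// ler_nat.
    by rewrite -addn3 leq_addr.
  exists n => //=; rewrite in_itv/=.
  move: nm; rewrite le_min; set d := _ / _ => /andP[? ?].
  by apply/andP; split; lra.
move=> [n _] /=; rewrite in_itv/= => /andP[ax xb].
have : 0 < (b - a) / n.+3%:R by rewrite divr_gt0.
move: ax xb; set d := _ / _ => ? ? ?.
by apply/andP; split; lra.
Qed.

(** Allows [f] to blow up at the endpoints, as t^(a-1) does at 0 for a < 1. The usual formula holds
    on the compact intervals [I n]; the integrals converge by monotone convergence and the values of
    [F] by its one-sided limits. *)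
Lemma ge0_FTC2_oo (R : realType) (f F : R -> R) (a b : R) : a < b ->
  {in `]a, b[, continuous f} ->
  {in `]a, b[, forall x : R, 0 <= f x} ->
  {in `]a, b[, forall x : R, is_derive x 1 F (f x)} ->
  F x @[x --> a^'+] --> F a -> F x @[x --> b^'-] --> F b ->
  (\int[lebesgue_measure]_(x in `[a, b]) (f x)%:E = (F b)%:E - (F a)%:E)%E.
Proof.
move=> ab cf f0 dF Fa Fb; have ba0 : 0 < b - a by rewrite subr_gt0.
pose d n : R := (b - a) / n.+3%:R.
have d0 n : 0 < d n by rewrite divr_gt0.
have d2 n : d n + d n < b - a.
  by rewrite -mulrDr -[X in _ < X]mulr1 ltr_pM2l// -mulr2n -[X in X < _]mulr_natl
    ltr_pdivrMr// mul1r ltr_nat.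
have dd m n : (m <= n)%N -> d n <= d m.
  by move=> mn; rewrite ler_pM2l// lef_pV2 ?posrE// ler_nat.
have dcvg : d n @[n --> \oo] --> (0 : R).
  rewrite -[X in _ --> X](mulr0 (b - a)); apply: cvgM; first exact: cvg_cst.
  rewrite (_ : (fun n => _) = [sequence harmonic (n + 2)%N]_n).
    by rewrite cvg_shiftn; exact: cvg_harmonic.
  by apply/funext => n; rewrite /harmonic/= addn2.
have mf : measurable_fun `]a, b[ f.
  apply: open_continuous_measurable_fun => // x.
  by rewrite inE/=; exact: cf.
have mfE : measurable_fun `]a, b[ (EFin \o f) by exact/measurable_EFinP.
(* The two endpoints are null sets and are removed. *)
rewrite -integral_itv_bndo_bndc; last first.
  apply/measurable_EFinP/measurable_fun_itv_obnd_cbndP; exact: mf.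
rewrite -integral_itv_obnd_cbnd//.
pose I n : set R := `[a + d n, b - d n]%classic.
have subI n x : I n x -> x \in `]a, b[.
  rewrite /I /= !in_itv/= => /andP[ax xb].
  by have := d0 n => ?; apply/andP; split; lra.
have cvgI : (\int[lebesgue_measure]_(x in I n) (f x)%:E)%E @[n --> \oo] -->
    (\int[lebesgue_measure]_(x in `]a, b[) (f x)%:E)%E.
  rewrite [X in integral _ X _](itv_oo_bigcup ab).
  apply: ge0_nondecreasing_set_cvg_integral.
  - move=> m n mn; rewrite subsetEset => x; rewrite /I/= !in_itv/=.
    by have := dd m n mn => ? /andP[? ?]; apply/andP; split; lra.
  - by move=> n; exact: measurable_itv.
  - move=> n; apply: measurable_funS mfE => //; exact: subI.
  - by move=> n x /subI /f0; rewrite lee_fin.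
have FTC n : (\int[lebesgue_measure]_(x in I n) (f x)%:E =
    (F (b - d n) - F (a + d n))%:E)%E.
  rewrite EFinB; have ? : a + d n < b - d n by have := d2 n; lra.
  have cF x : x \in `]a, b[ -> {for x, continuous F}.
    move=> /dF [dFx _].
    by apply: differentiable_continuous; exact/derivable1_diffP.
  have sI x : x \in `[a + d n, b - d n] -> x \in `]a, b[ by exact: subI.
  apply: continuous_FTC2 => //.
  - apply: continuous_in_subspaceT => x; rewrite inE => /subI; exact: cf.
  - have cI : {within `[a + d n, b - d n], continuous F}.
      by apply: continuous_in_subspaceT => x; rewrite inE => /subI; exact: cF.
    split.
    + move=> x xI; have /dF[//] : x \in `]a, b[.
      by apply: sI; exact: subset_itv_oo_cc.
    + by move/continuous_within_itvP: cI => /(_ ltac:(assumption))[].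
    + by move/continuous_within_itvP: cI => /(_ ltac:(assumption))[].
  - move=> x xI; rewrite derive1E; have /dF[_ //] : x \in `]a, b[.
    by apply: sI; exact: subset_itv_oo_cc.
apply: (cvg_unique _ cvgI) => //.
rewrite (funext FTC).
rewrite -EFinB; apply: cvg_EFin; first exact: nearW.
apply: cvgB.
  move/cvg_at_leftP: Fb; apply; split.
    by move=> n; rewrite ltrBlDr ltrDl.
  by rewrite -[X in _ --> X]subr0; apply: cvgB => //; exact: cvg_cst.
move/cvg_at_rightP: Fa; apply; split.
  by move=> n; rewrite ltrDl.
by rewrite -[X in _ --> X]addr0; apply: cvgD => //; exact: cvg_cst.
Qed.

(** On the open interval |f| = f, so [F] is also an antiderivative of |f|, whose integral is then
    the finite F(b) - F(a). *)
Lemma ge0_FTC2_oo_integrable (R : realType) (f F : R -> R) (a b : R) : a < b ->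
  {in `]a, b[, continuous f} ->
  {in `]a, b[, forall x : R, 0 <= f x} ->
  {in `]a, b[, forall x : R, is_derive x 1 F (f x)} ->
  F x @[x --> a^'+] --> F a -> F x @[x --> b^'-] --> F b ->
  lebesgue_measure.-integrable `[a, b] (EFin \o f).
Proof.
move=> ab cf f0 dF Fa Fb; apply/integrableP; split.
  apply/measurable_EFinP/measurable_fun_itv_bndo_bndcP.
  apply/measurable_fun_itv_obnd_cbndP.
  apply: open_continuous_measurable_fun => // x.
  by rewrite inE/=; exact: cf.
have cnf : {in `]a, b[, continuous (fun x => `|f x|)}.
  by move=> x xab; apply: cvg_norm; exact: cf.
have dF' : {in `]a, b[, forall x : R, is_derive x 1 F `|f x|}.
  by move=> x xab; rewrite ger0_norm ?f0//; exact: dF.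
have nf0 : {in `]a, b[, forall x : R, 0 <= `|f x|} by [].
have := ge0_FTC2_oo ab cnf nf0 dF' Fa Fb.
rewrite /= => ->.
by rewrite -EFinB ltry.
Qed.

(** * The kernel of the Beta integral: continuity, antiderivatives and integrability *)

Definition beta_kernel (R : realType) (a b t : R) : R :=
  t `^ (a - 1) * (1 - t) `^ (b - 1).

Lemma beta_kernel_ge0 (R : realType) (a b t : R) : 0 <= beta_kernel a b t.
Proof. by rewrite mulr_ge0// powR_ge0. Qed.

Lemma measurable_beta_kernel (R : realType) (a b : R) (D : set R) :
  measurable_fun D (beta_kernel a b).
Proof.
apply: measurable_funTS; apply: measurable_funM.
  exact: measurable_powR.
apply: (measurableT_comp (measurable_powR _)) => //.
by apply: measurable_funB.
Qed.

(** The endpoint t = 0 is included, where t t^(a-1) = t^a relies on a > 0. *)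
Lemma beta_kernelMl (R : realType) (a b t : R) : 0 < a -> 0 <= t ->
  beta_kernel a b t * t = beta_kernel (a + 1) b t.
Proof.
move=> a0 t0; rewrite /beta_kernel addrK -(mulr_powRB1 t0 a0).
by rewrite mulrAC mulrC (mulrC t) mulrC.
Qed.

Lemma beta_kernelMr (R : realType) (a b t : R) : 0 < b -> t <= 1 ->
  beta_kernel a b t * (1 - t) = beta_kernel a (b + 1) t.
Proof.
move=> b0 t1; have t0 : 0 <= 1 - t by rewrite subr_ge0.
by rewrite /beta_kernel addrK -(mulr_powRB1 t0 b0) -mulrA (mulrC (1 - t)).
Qed.

Lemma is_derive_powR_onem (R : realType) (b x : R) : x < 1 ->
  is_derive x (1 : R) (fun t : R => (1 - t) `^ b) (- (b * (1 - x) `^ (b - 1))).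
Proof.
move=> x1; have x0 : 0 < 1 - x by rewrite subr_gt0.
have H1 := is_derive1_powR b x0.
have H2 : is_derive x (1 : R) (fun t : R => 1 - t) (- 1).
  have := is_deriveB (is_derive_cst (1 : R) x 1) (is_derive_id x (1 : R)).
  by rewrite sub0r.
have := @is_derive1_comp R (fun y : R => y `^ b) (fun t : R => 1 - t) x _ _ H1 H2.
by rewrite mulrN1.
Qed.

Lemma continuous_powR (R : realType) (a x : R) : 0 < x ->
  {for x, continuous (@powR R ^~ a)}.
Proof.
move=> x0; apply: differentiable_continuous; apply/derivable1_diffP.
by apply: derivable_powR; rewrite in_itv/= x0.
Qed.

Lemma continuous_powR_onem (R : realType) (b x : R) : x < 1 ->
  {for x, continuous (fun t : R => (1 - t) `^ b)}.
Proof.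
move=> x1; apply: differentiable_continuous; apply/derivable1_diffP.
by have [] := is_derive_powR_onem b x1.
Qed.

Lemma continuous_beta_kernel (R : realType) (a b : R) :
  {in `]0, 1[, continuous (beta_kernel a b)}.
Proof.
move=> x; rewrite in_itv/= => /andP[x0 x1].
by apply: cvgM; [exact: continuous_powR | exact: continuous_powR_onem].
Qed.

Lemma powR_onem_cvg0 (R : realType) (b : R) : 0 < b ->
  (1 - t) `^ b @[t --> (1 : R)^'-] --> (0 : R).
Proof.
move=> b0; apply/cvg_at_leftP => u [u1 ucvg].
have /cvg_at_rightP := powR_cvg0 b0; apply; split.
  by move=> n; rewrite subr_gt0.
rewrite -[X in _ --> X](subrr 1); apply: cvgB => //; exact: cvg_cst.
Qed.

Lemma powR_le1 (R : realType) (c s : R) : 0 < c -> 0 <= s -> s <= 1 ->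
  s `^ c <= 1.
Proof.
move=> c0 s0 s1; have <- : 1 `^ c = 1 :> R by rewrite powR1.
by rewrite ge0_ler_powR// ?nnegrE// ltW.
Qed.

Section beta_FTC.
Variables (R : realType) (a b : R).
Hypotheses (a0 : 0 < a) (b0 : 0 < b).

Let p0 : t `^ a @[t --> (0:R)^'+] --> (0:R) `^ a.
Proof. by rewrite powR0 ?gt_eqF//; exact: powR_cvg0. Qed.

Let p1 : t `^ a @[t --> (1:R)^'-] --> (1:R) `^ a.
Proof. by apply: cvg_at_left_filter; exact: continuous_powR. Qed.

Let q0 : (1 - t) `^ b @[t --> (0:R)^'+] --> (1 - 0 : R) `^ b.
Proof. by apply: cvg_at_right_filter; exact: continuous_powR_onem. Qed.

Let q1 : (1 - t) `^ b @[t --> (1:R)^'-] --> (1 - 1 : R) `^ b.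
Proof. by rewrite subrr powR0 ?gt_eqF//; exact: powR_onem_cvg0. Qed.

(** Valid also at t = 1, by the convention 0^0 = 1. *)
Lemma beta_kernelp1E (t : R) : beta_kernel a 1 t = t `^ (a - 1).
Proof. by rewrite /beta_kernel subrr powRr0 mulr1. Qed.

Lemma beta_kernel1pE (t : R) : beta_kernel 1 b t = (1 - t) `^ (b - 1).
Proof. by rewrite /beta_kernel subrr powRr0 mul1r. Qed.

Let dp (x : R) : x \in `]0, 1[ -> is_derive x 1 (@powR R ^~ a) (a * beta_kernel a 1 x).
Proof.
by rewrite in_itv/= => /andP[x0 x1]; rewrite beta_kernelp1E; exact: is_derive1_powR.
Qed.

Let dq (x : R) : x \in `]0, 1[ ->
  is_derive x 1 (fun t : R => (1 - t) `^ b) (- (b * beta_kernel 1 b x)).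
Proof.
by rewrite in_itv/= => /andP[x0 x1]; rewrite beta_kernel1pE; exact: is_derive_powR_onem.
Qed.

Let cZ (c d e : R) : {in `]0, 1[, continuous (fun t : R => c * beta_kernel d e t)}.
Proof.
by move=> x x01; apply: cvgM; [exact: cvg_cst|exact: continuous_beta_kernel].
Qed.

Let Z0 (c d e : R) : 0 < c -> {in `]0, 1[, forall t : R, 0 <= c * beta_kernel d e t}.
Proof. by move=> c0 x _; rewrite mulr_ge0 ?beta_kernel_ge0// ltW. Qed.

Let IntZ (c d e : R) : 0 < c ->
  lebesgue_measure.-integrable `[0, 1] (EFin \o (fun t : R => c * beta_kernel d e t)) ->
  lebesgue_measure.-integrable `[0, 1] (EFin \o (beta_kernel d e)).
Proof.
move=> c0 H.
have : lebesgue_measure.-integrable `[0, 1]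
    (fun x : R => c^-1%:E * (EFin \o (fun t : R => (c * beta_kernel d e t)%R)) x)%E.
  exact: integrableZl.
apply: eq_integrable => //.
by move=> x _ /=; rewrite -EFinM mulKf// gt_eqF.
Qed.

(** The antiderivative t^a of a t^(a-1) has finite limits at both endpoints because a > 0. *)
Lemma integrable_beta_kernelp1 :
  lebesgue_measure.-integrable `[0, 1] (EFin \o beta_kernel a 1).
Proof.
exact: IntZ a0 (ge0_FTC2_oo_integrable ltr01 (@cZ a a 1) (@Z0 a a 1 a0) dp p0 p1).
Qed.

Lemma integrable_beta_kernel1p :
  lebesgue_measure.-integrable `[0, 1] (EFin \o beta_kernel 1 b).
Proof.
apply: IntZ b0 (@ge0_FTC2_oo_integrable _ _ (fun t : R => - (1 - t) `^ b) 0 1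
  ltr01 (@cZ b 1 b) (@Z0 b 1 b b0) _ (cvgN q0) (cvgN q1)).
by move=> x /dq H; rewrite -[X in is_derive _ _ _ X]opprK; exact: is_deriveN.
Qed.

Lemma euler_betap1 : a * euler_beta a 1 = 1.
Proof.
rewrite -RintegralZl//; last exact: integrable_beta_kernelp1.
have := ge0_FTC2_oo (@ltr01 R) (@cZ a a 1) (@Z0 a a 1 a0) dp p0 p1.
by rewrite /Rintegral => ->; rewrite /= powR1 powR0 ?gt_eqF// subr0.
Qed.

(** Splitting 1 = (1-t) + t separates the two singularities: the kernel is t^(a-1) (1-t)^b + t^a
    (1-t)^(b-1), dominated by t^(a-1) + (1-t)^(b-1). *)
Lemma integrable_beta_kernel :
  lebesgue_measure.-integrable `[0, 1] (EFin \o beta_kernel a b).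
Proof.
have : lebesgue_measure.-integrable `[0, 1]
    ((EFin \o beta_kernel a 1) \+ (EFin \o beta_kernel 1 b))%E.
  apply: integrableD => //.
    exact: integrable_beta_kernelp1.
  exact: integrable_beta_kernel1p.
apply: le_integrable => //.
- by apply/measurable_EFinP; exact: measurable_beta_kernel.
- move=> t /=; rewrite in_itv/= => /andP[t0 t1]; rewrite lee_fin.
  rewrite !ger0_norm ?addr_ge0 ?beta_kernel_ge0//.
  have -> : beta_kernel a b t = beta_kernel a b t * (1 - t) + beta_kernel a b t * t.
    by ring.
  rewrite beta_kernelMr// beta_kernelMl// beta_kernelp1E beta_kernel1pE.
  have t'0 : 0 <= 1 - t by rewrite subr_ge0.
  rewrite /beta_kernel !addrK lerD//.
    by rewrite ler_piMr ?powR_ge0// powR_le1// lerBlDr lerDl.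
  by rewrite ler_piMl ?powR_ge0// powR_le1.
Qed.

(* [t^a (1 - (1-t)^b)] goes from 0 to 1, and its derivative is
   [a t^(a-1) - a t^(a-1) (1-t)^b + b t^a (1-t)^(b-1) >= 0]. *)
Lemma Rintegral_beta_balance :
  \int[lebesgue_measure]_(t in `[0, 1]) (a * beta_kernel a 1 t -
    a * beta_kernel a (b + 1) t + b * beta_kernel (a + 1) b t) = 1.
Proof.
pose f (t : R) := a * beta_kernel a 1 t - a * beta_kernel a (b + 1) t
  + b * beta_kernel (a + 1) b t.
(* The derivative of t^a (1-t)^b alone changes sign; subtracting this product from t^a gives the
   nonnegative integrand that [ge0_FTC2_oo] requires. *)
pose F (t : R) := t `^ a - t `^ a * (1 - t) `^ b.
have cf : {in `]0, 1[, continuous f}.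
  move=> x x01; apply: cvgD; last exact: cZ.
  by apply: cvgB; exact: cZ.
have f0 : {in `]0, 1[, forall t : R, 0 <= f t}.
  move=> t; rewrite in_itv/= => /andP[t0 t1].
  have t'0 : 0 <= 1 - t by rewrite subr_ge0 ltW.
  rewrite addr_ge0//; last by rewrite mulr_ge0 ?beta_kernel_ge0// ltW.
  rewrite -mulrBr mulr_ge0 ?(ltW a0)// beta_kernelp1E subr_ge0 /beta_kernel addrK.
  rewrite ler_piMr ?powR_ge0// powR_le1//.
  by rewrite lerBlDr lerDl ltW.
have dF : {in `]0, 1[, forall t : R, is_derive t 1 F (f t)}.
  move=> t t01.
  have := is_deriveB (dp t01) (is_deriveM (dp t01) (dq t01)).
  suff -> : f t = a * beta_kernel a 1 t -
     (t `^ a *: - (b * beta_kernel 1 b t) + (1 - t) `^ b *: (a * beta_kernel a 1 t)) by [].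
  rewrite /GRing.scale/= /f beta_kernel1pE beta_kernelp1E /beta_kernel !addrK; ring.
have F0 : F x @[x --> (0 : R)^'+] --> F 0 by exact: cvgB p0 (cvgM p0 q0).
have F1 : F x @[x --> (1 : R)^'-] --> F 1 by exact: cvgB p1 (cvgM p1 q1).
have := ge0_FTC2_oo ltr01 cf f0 dF F0 F1.
rewrite /Rintegral => ->.
by rewrite /F/= !subrr powR1 !powR0 ?gt_eqF// mulr0 !mul0r !subr0.
Qed.

End beta_FTC.

(** * Recurrences and positivity of the Beta function *)

Section euler_beta_theory.
Variable R : realType.
Implicit Types a b x : R.

(** Integration by parts in disguise: integrating the balance identity term by term, with a B(a,1) =
    1, gives 1 - a B(a,b+1) + b B(a+1,b) = 1. *)
Lemma euler_betaDr a b : 0 < a -> 0 < b ->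
  a * euler_beta a (b + 1) = b * euler_beta (a + 1) b.
Proof.
move=> a0 b0; have b1 : 0 < b + 1 by rewrite addr_gt0.
have a1 : 0 < a + 1 by rewrite addr_gt0.
have IZ (c d e : R) : 0 < d -> 0 < e -> lebesgue_measure.-integrable `[0, 1]
    (EFin \o (fun t : R => c * beta_kernel d e t)).
  move=> d0 e0.
  have : lebesgue_measure.-integrable `[0, 1]
      (fun t : R => c%:E * (EFin \o beta_kernel d e) t)%E.
    by apply: integrableZl => //; exact: integrable_beta_kernel.
  by apply: eq_integrable.
have E (c d e : R) : 0 < d -> 0 < e ->
    \int[lebesgue_measure]_(t in `[0, 1]) (c * beta_kernel d e t) = c * euler_beta d e.
  by move=> d0 e0; rewrite RintegralZl//; exact: integrable_beta_kernel.
have IB : lebesgue_measure.-integrable `[0, 1]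
    (EFin \o (fun t : R => a * beta_kernel a 1 t - a * beta_kernel a (b + 1) t)).
  have : lebesgue_measure.-integrable `[0, 1]
      ((EFin \o (fun t => (a * beta_kernel a 1 t)%R)) \-
       (EFin \o (fun t => (a * beta_kernel a (b + 1) t)%R)))%E.
    by apply: integrableB => //; exact: IZ.
  by apply: eq_integrable.
have alg (X Y : R) : 1 - X + Y = 1 -> X = Y by lra.
apply: alg; rewrite -[RHS](Rintegral_beta_balance a0 b0).
rewrite (RintegralD _ IB (IZ _ _ _ a1 b0))//.
rewrite (RintegralB _ (IZ _ _ _ a0 ltr01) (IZ _ _ _ a0 b1))//.
rewrite (E _ _ _ a0 ltr01) (E _ _ _ a0 b1) (E _ _ _ a1 b0) euler_betap1//.
Qed.

(** This is (1-t) + t = 1 under the integral. *)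
Lemma euler_betaD a b : 0 < a -> 0 < b ->
  euler_beta a (b + 1) + euler_beta (a + 1) b = euler_beta a b.
Proof.
move=> a0 b0; have b1 : 0 < b + 1 by rewrite addr_gt0.
have a1 : 0 < a + 1 by rewrite addr_gt0.
rewrite -RintegralD//; try exact: integrable_beta_kernel.
apply: eq_Rintegral => t; rewrite inE/= in_itv/= => /andP[t0 t1].
rewrite -!/(beta_kernel _ _ _) -beta_kernelMl// -beta_kernelMr//; ring.
Qed.

(** [euler_betaDr] and [euler_betaD] form a linear system for B(a+1,b) and B(a,b+1). *)
Lemma euler_betaSl a b : 0 < a -> 0 < b ->
  euler_beta (a + 1) b = a / (a + b) * euler_beta a b.
Proof.
move=> a0 b0; have ab0 : a + b != 0 by rewrite gt_eqF// addr_gt0.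
rewrite -(euler_betaD a0 b0) mulrAC mulrDr (euler_betaDr a0 b0).
by field.
Qed.

Lemma euler_betaSr a b : 0 < a -> 0 < b ->
  euler_beta a (b + 1) = b / (a + b) * euler_beta a b.
Proof.
move=> a0 b0; have ab0 : a + b != 0 by rewrite gt_eqF// addr_gt0.
rewrite -(euler_betaD a0 b0) mulrAC mulrDr -(euler_betaDr a0 b0).
by field.
Qed.

(** For b <= 1 one has (1-t)^b >= 1-t, so B(a,b+1) >= B(a,2), and [euler_betaSr] turns both sides
    into positive multiples of B(a,b) and B(a,1) = 1/a. Larger [b] is lowered by one with the same
    recurrence, by induction on an integer bound. *)
Lemma euler_beta_gt0 a b : 0 < a -> 0 < b -> 0 < euler_beta a b.
Proof.
move=> a0 b0; have [m bm] : exists m : nat, b <= m.+1%:R.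
  exists (Num.bound b); rewrite ltW// (lt_le_trans (archi_boundP (ltW b0)))//.
  by rewrite ler_nat.
elim: m b b0 bm => [|m IH] b b0 bm.
  have b1 : 0 < b + 1 by rewrite addr_gt0.
  have : euler_beta a (1 + 1) <= euler_beta a (b + 1).
    apply: le_Rintegral => //; try exact: integrable_beta_kernel.
    move=> t /=; rewrite in_itv/= => /andP[t0 t1].
    have t'0 : 0 <= 1 - t by rewrite subr_ge0.
    rewrite ler_wpM2l ?powR_ge0// !addrK powRr1//.
    move: t1; rewrite le_eqVlt => /predU1P[->|t1]; first by rewrite subrr powR_ge0.
    by rewrite ger1_powR// subr_gt0 t1 lerBlDr lerDl.
  rewrite (euler_betaSr a0 ltr01) (euler_betaSr a0 b0) => H.
  have Ba1 : 0 < euler_beta a 1 by rewrite -(pmulr_rgt0 _ a0) euler_betap1.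
  have ab0 : 0 < b / (a + b) by rewrite divr_gt0// addr_gt0.
  rewrite -(pmulr_rgt0 _ ab0); apply: lt_le_trans H.
  by rewrite pmulr_rgt0// divr_gt0// addr_gt0.
have [b1|b1] := leP b 1.
  by apply: IH => //; rewrite (le_trans b1)// ler1n.
have b'0 : 0 < b - 1 by rewrite subr_gt0.
rewrite -(subrK 1 b) (euler_betaSr a0 b'0); apply: mulr_gt0.
  by rewrite divr_gt0// addr_gt0.
by apply: (IH _ b'0); rewrite lerBlDr natr1.
Qed.

End euler_beta_theory.

(** * The genuine Beta operator on polynomials *)

(** At a = nx and a + b = n the ratio is the value (nx)_k / (n)_k of the operator on e_k. *)
Lemma euler_betaDnl (R : realType) (a b : R) k : 0 < a -> 0 < b ->
  euler_beta (a + k%:R) b = rising a k / rising (a + b) k * euler_beta a b.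
Proof.
move=> a0 b0; have ab0 : 0 < a + b by rewrite addr_gt0.
elim: k => [|k IH].
  by rewrite addr0 /rising !big_ord0 divr1 mul1r.
have ak0 : 0 < a + k%:R by rewrite ltr_wpDr.
rewrite -natr1 addrA (euler_betaSl ak0 b0) IH !risingS.
have n1 : rising (a + b) k != 0 by rewrite gt_eqF// rising_gt0.
have n2 : a + b + k%:R != 0 by rewrite gt_eqF// ltr_wpDr.
have -> : a + k%:R + b = a + b + k%:R by rewrite addrAC.
move: (euler_beta a b) (rising a k) (rising (a + b) k) n1 => B x y n1.
by field; apply/andP; split.
Qed.

Lemma beta_kernelMXn (R : realType) (a b t : R) k : 0 < a -> 0 <= t ->
  beta_kernel a b t * t ^+ k = beta_kernel (a + k%:R) b t.
Proof.
move=> a0 t0; elim: k => [|k IH]; first by rewrite expr0 mulr1 addr0.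
rewrite exprSr mulrA IH beta_kernelMl//; last by rewrite ltr_wpDr.
by rewrite -addrA natr1.
Qed.

Lemma Rintegral_beta_kernel_sum (R : realType) (a b : R) (c : nat -> R) m :
  0 < a -> 0 < b ->
  \int[lebesgue_measure]_(t in `[0, 1])
    (\sum_(k < m) c k * beta_kernel (a + k%:R) b t) =
  \sum_(k < m) c k * euler_beta (a + k%:R) b.
Proof.
move=> a0 b0.
have ak0 k : 0 < a + k%:R by rewrite ltr_wpDr.
have IZ k : lebesgue_measure.-integrable `[0, 1]
    (EFin \o (fun t : R => c k * beta_kernel (a + k%:R) b t)).
  have : lebesgue_measure.-integrable `[0, 1]
      (fun t : R => (c k)%:E * (EFin \o beta_kernel (a + k%:R) b) t)%E.
    by apply: integrableZl => //; exact: integrable_beta_kernel.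
  by apply: eq_integrable.
have IS n : lebesgue_measure.-integrable `[0, 1]
    (EFin \o (fun t : R => \sum_(k < n) c k * beta_kernel (a + k%:R) b t)).
  have : lebesgue_measure.-integrable `[0, 1]
      (fun t : R => \sum_(k < n) (c k * beta_kernel (a + k%:R) b t)%:E)%E.
    by apply: integrable_sum => // k _; exact: IZ.
  by apply: eq_integrable => // t _; rewrite sumEFin.
elim: m => [|m IH].
  under eq_Rintegral do rewrite big_ord0.
  by rewrite big_ord0 Rintegral_cst// mul0r.
rewrite big_ord_recr -IH.
under eq_Rintegral do rewrite big_ord_recr.
rewrite (RintegralD _ (IS m) (IZ m))//; congr (_ + _).
by rewrite RintegralZl//; exact: integrable_beta_kernel.
Qed.

(** Inside the interval, integrate p monomial by monomial. At the endpoints the model agrees with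
    p(0) and p(1), because (0)_k vanishes for k > 0 and (n)_k / (n)_k = 1. *)
Lemma genuine_beta_horner (R : realType) (n : nat) (p : {poly R}) (x : R) :
  (0 < n)%N -> (size p <= n.+1)%N -> 0 <= x <= 1 ->
  genuine_beta n (horner p) x = (beta_poly n p).[x].
Proof.
move=> n0 sp /andP[x0 x1]; have nR0 : 0 < n%:R :> R by rewrite ltr0n.
have -> : (beta_poly n p).[x] =
    \sum_(k < n.+1) p`_k * (rising (n%:R * x) k / rising n%:R k).
  rewrite /beta_poly horner_sum; apply: eq_bigr => k _.
  by rewrite hornerZ horner_rising hornerZ hornerX mulrAC mulrA.
rewrite /genuine_beta; case: eqP => [->|/eqP xn0].
  rewrite big_ord_recl mulr0 big1 => [|k _]; last first.
    by rewrite rising0/= mul0r mulr0.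
  by rewrite rising0/= /rising big_ord0 divr1 mulr1 addr0 horner_coef0.
case: eqP => [->|/eqP xn1].
  rewrite (horner_coef_wide _ sp); apply: eq_bigr => k _.
  by rewrite mulr1 divff ?expr1n// gt_eqF// rising_gt0.
have a0 : 0 < n%:R * x by rewrite mulr_gt0// lt_neqAle eq_sym xn0.
have b0 : 0 < n%:R * (1 - x) by rewrite mulr_gt0// subr_gt0 lt_neqAle xn1.
(* The parameters add up to [n], so the denominators (a+b)_k do not depend on [x]. *)
have abn : n%:R * x + n%:R * (1 - x) = n%:R by rewrite -mulrDr addrC subrK mulr1.
move: a0 b0 abn; set a := n%:R * x; set b := n%:R * (1 - x) => a0 b0 abn.
have -> : \int[lebesgue_measure]_(t in `[0, 1])
      (t `^ (a - 1) * (1 - t) `^ (b - 1) * p.[t]) =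
    \int[lebesgue_measure]_(t in `[0, 1])
      (\sum_(k < n.+1) p`_k * beta_kernel (a + k%:R) b t).
  apply: eq_Rintegral => t; rewrite inE/= in_itv/= => /andP[t0 _].
  rewrite (horner_coef_wide _ sp) mulr_sumr; apply: eq_bigr => k _.
  by rewrite -beta_kernelMXn// mulrCA.
rewrite (Rintegral_beta_kernel_sum (fun k => p`_k))// mulr_sumr.
apply: eq_bigr => k _; rewrite euler_betaDnl// abn.
have B0 : euler_beta a b != 0 by rewrite gt_eqF// euler_beta_gt0.
by rewrite mulrCA; congr (_ * _); rewrite mulrC mulfK.
Qed.

(** [xget] must return [p] once the preimage is unique: for a second one, [beta_poly] of the
    difference vanishes on [0,1], hence is the zero polynomial, and injectivity applies. *)
Lemma genuine_beta_invE (R : realType) (n : nat) (p : {poly R}) :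
  (0 < n)%N -> (size p <= n.+1)%N -> genuine_beta_inv n (beta_poly n p) = p.
Proof.
move=> n0 sp; apply: xget_unique => /=.
  by split=> // x; exact: genuine_beta_horner.
move=> q [sq qp]; apply/eqP; rewrite -subr_eq0; apply/eqP.
apply: (@beta_poly_eq0 _ n) => //.
  by rewrite (leq_trans (size_polyD _ _))// geq_max size_polyN sq.
rewrite linearB; apply: poly_eq0_unit_itv => x x01.
by rewrite /= hornerD hornerN -(genuine_beta_horner n0 sq x01) qp// subrr.
Qed.

Unset Implicit Arguments.

Theorem mainTheorem9 (R : realType) (n : nat) (f : R -> R) :
  (1 <= n)%N -> {within `[0, 1], continuous f} ->
  F_op n f =
  \sum_(j < n.+1) divided_diff f (fun i => i%:R / n%:R) 0 j *: rho R n j.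
Proof.
move=> n0 _; rewrite /F_op bernstein_beta_poly// genuine_beta_invE//.
(* What remains is the degree bound: each [rho R n j] has degree at most j <= n. *)
apply: (leq_trans (size_sum _ _ _)); apply/bigmax_leqP => j _.
rewrite (leq_trans (size_scale_leq _ _))// (leq_trans (size_rho _ _ _))//.
Qed.
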